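(* Let $A,B:\mathbb{R}^n\rightrightarrows\mathbb{R}^n$ and let $\mu_A,\rho_A,\mu_B,\rho_B\in\mathbb{R}$ satisfy (P) either $\mu_A+\mu_B>0$ or $\mu_A=\mu_B=0$; either $\rho_A+\rho_B>0$ or $\rho_A=\rho_B=0$; and $[\mu_A\Box\mu_B]_-[\rho_A\Box\rho_B]_-<\tfrac14$. Put $$\gamma_-:=-\frac{2(\rho_A\Box\rho_B)}{1+\sqrt{1-4(\mu_A\Box\mu_B)(\rho_A\Box\rho_B)}},\qquad \gamma_+:=-\frac{1+\sqrt{1-4(\mu_A\Box\mu_B)(\rho_A\Box\rho_B)}}{2(\mu_A\Box\mu_B)},$$ and let the stepsize $\gamma$ be selected as follows. - If $\rho_A=\rho_B=0$: $\gamma\in(0,+\infty)$ when $\mu_A=\mu_B=0$ or ($\mu_A+\mu_B>0$ and $\mu_A\mu_B\ge0$); $\gamma\in\big(0,-\tfrac{1}{\mu_A\Box\mu_B}\big)$ when $\mu_A+\mu_B>0$ and $\mu_A\mu_B<0$. - If $\rho_A+\rho_B>0$ and $\rho_A\rho_B\ge0$: $\gamma\in(0,+\infty)$ when $\mu_A=\mu_B=0$ or ($\mu_A+\mu_B>0$ and $\mu_A\mu_B\ge0$); $\gamma\in(0,\gamma_+)$ when $\mu_A+\mu_B>0$ and $\mu_A\mu_B<0$. - If $\rho_A+\rho_B>0$ and $\rho_A\rho_B<0$: $\gamma\in(-(\rho_A\Box\rho_B),+\infty)$ when $\mu_A=\mu_B=0$; $\gamma\in(\gamma_-,+\infty)$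 when $\mu_A+\mu_B>0$ and $\mu_A\mu_B\ge0$; $\gamma\in(\gamma_-,\gamma_+)$ when $\mu_A+\mu_B>0$ and $\mu_A\mu_B<0$. Suppose that either (a) or (b) holds: (a) $A$ and $B$ are outer semicontinuous, $\operatorname{dom}J_{\gamma A}=\operatorname{dom}J_{\gamma B}=\mathbb{R}^n$, and there is a nonempty set $\mathcal{S}^\star\subseteq\operatorname{zer}T_{\mathrm{PD}}$ such that for every $(x^\star,y^\star)\in\mathcal{S}^\star$, $A$ is $(\mu_A,\rho_A)$-semimonotone at $(x^\star,-y^\star)\in\operatorname{gph}A$ and $B$ is $(\mu_B,\rho_B)$-semimonotone at $(x^\star,y^\star)\in\operatorname{gph}B$; (b) $\operatorname{zer}(A+B)$ is nonempty, $A$ is maximally $(\mu_A,\rho_A)$-semimonotone and $B$ is maximally $(\mu_B,\rho_B)$-semimonotone; in this case put $\mathcal{S}^\star:=\operatorname{zer}T_{\mathrm{PD}}$. Then $\alpha:=1+\tfrac1\gamma(\rho_A\Box\rho_B)+\gamma(\mu_A\Box\mu_B)>0$. Consider a sequence $(u^k,v^k,s^k)_{k\in\mathbb{N}}$ generated by Douglas–Rachford splitting (DRS) starting from $s^0\in\mathbb{R}^n$ with stepsize $\gamma$ and relaxation parameters $\lambda_k\in(0,2\alpha)$ such that $\liminf_{k\to\infty}\lambda_k(2\alpha-\lambda_k)>0$. Then either a point for which $u^k=v^k$ is reached in a finite number of iterations, implying that $\big(u^k,\tfrac1\gamma(u^k-s^k)\big)\in\operatorname{zer}T_{\mathrm{PD}}$,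 or the following hold. (i) $\gamma^{-1}(u^k-v^k)\in Au^k+Bv^k$ for all $k$, and $(u^k-v^k)_{k\in\mathbb{N}}$ converges to zero. (ii) Every limit point (if any) of $\big(u^k,\tfrac1\gamma(u^k-s^k)\big)_{k\in\mathbb{N}}$ belongs to $\operatorname{zer}T_{\mathrm{PD}}$. (iii) $(s^k)_{k\in\mathbb{N}}$ is bounded and its limit points belong to $\{x^\star-\gamma y^\star\mid(x^\star,y^\star)\in\operatorname{zer}T_{\mathrm{PD}}\}$. (iv) If $\lambda_k(2\alpha-\lambda_k)\ge\kappa>0$ uniformly for all $k$, then for all $s^\star\in\{x^\star-\gamma y^\star\mid(x^\star,y^\star)\in\mathcal{S}^\star\}$ and all $N\in\mathbb{N}$, $\min_{k=0,\dots,N}\|u^k-v^k\|^2\le\frac{\|s^0-s^\star\|^2}{(N+1)\kappa}$. (v) If $\Pi\mathcal{S}^\star=\Pi\operatorname{zer}T_{\mathrm{PD}}$, then $(s^k)_{k\in\mathbb{N}}$ converges to some element of $\{x^\star-\gamma y^\star\mid(x^\star,y^\star)\in\operatorname{zer}T_{\mathrm{PD}}\}$. If additionally $J_{\gamma A}$ and $J_{\gamma B}$ are (single-valued) continuous, then $\big(u^k,\tfrac1\gamma(u^k-s^k)\big)_{k\in\mathbb{N}}$ converges to some element of $\operatorname{zer}T_{\mathrm{PD}}$. Furthermore, if (b) holds and $\lambda_k(2\alpha-\lambda_k)\ge\kappa>0$ uniformly for all $k$, then for all $s^\star\in\{x^\star-\gamma y^\star\mid(x^\star,y^\star)\in\operatorname{zer}T_{\mathrm{PD}}\}$,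 $$\|u^N-v^N\|^2\le\frac{\|s^0-s^\star\|^2}{(N+1)\kappa}\qquad\text{and}\qquad\|u^N-v^N\|^2=o\big(1/(N+1)\big).$$
   Context: For a set-valued operator $T$: $\operatorname{gph}T=\{(x,y):y\in Tx\}$, $\operatorname{zer}T=\{x:0\in Tx\}$, $\operatorname{dom}T=\{x:Tx\ne\emptyset\}$; $T$ is outer semicontinuous if its graph is closed. Resolvent: $J_A=(\mathrm{id}+A)^{-1}$. $[t]_-=\min\{0,t\}$. Parallel sum of reals: $a\Box b=0$ if $a=b=0$, and $a\Box b=\frac{ab}{a+b}$ if $a+b\ne0$. Semimonotonicity: $A$ is $(\mu,\rho)$-semimonotone at $(x',y')\in\operatorname{gph}A$ if $\langle x-x',y-y'\rangle\ge\mu\|x-x'\|^2+\rho\|y-y'\|^2$ for all $(x,y)\in\operatorname{gph}A$; it is $(\mu,\rho)$-semimonotone if this holds at all $(x',y')\in\operatorname{gph}A$; it is maximally $(\mu,\rho)$-semimonotone if moreover its graph is not strictly contained in the graph of another $(\mu,\rho)$-semimonotone operator. (DRS): $u^k\in J_{\gamma A}(s^k)$, $v^k\in J_{\gamma B}(2u^k-s^k)$, $s^{k+1}=s^k+\lambda_k(v^k-u^k)$. Primal-dual operator on $\mathbb{R}^{2n}$: $T_{\mathrm{PD}}(x,y)=\big(Ax+y\big)\times\big(B^{-1}y-x\big)$; $(x^\star,y^\star)\in\operatorname{zer}T_{\mathrm{PD}}$ iff $(x^\star,-y^\star)\in\operatorname{gph}A$ and $(x^\star,y^\star)\in\operatorname{gph}B$.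 $\Pi$ is the orthogonal projection in $\mathbb{R}^{2n}$ onto the range of $\begin{bmatrix}\gamma^{-1}\mathrm{I}_n&-\mathrm{I}_n\\-\mathrm{I}_n&\gamma\mathrm{I}_n\end{bmatrix}$. $a_N=o(1/(N+1))$ means $(N+1)a_N\to0$. *)

(* Defs.v *)
From mathcomp Require Import all_boot all_order all_algebra.
From mathcomp Require Import all_classical all_reals all_analysis.

Set Implicit Arguments.
Unset Strict Implicit.
Unset Printing Implicit Defensive.

Import Order.TTheory GRing.Theory Num.Theory.
Import numFieldNormedType.Exports.

Local Open Scope classical_set_scope.
Local Open Scope ring_scope.

(* The library norm on matrices is the max norm: it is only used here through
   the topology and the notion of boundedness it induces, which are the
   Euclidean ones. *)
Definition dot (R : realType) (n : nat) (x y : 'cV[R]_n) : R :=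
  \sum_i x i ord0 * y i ord0.

Definition enorm (R : realType) (n : nat) (x : 'cV[R]_n) : R :=
  Num.sqrt (dot x x).

Section SetValuedOperators.
Variables (R : realType) (n : nat).

Definition setop := 'cV[R]_n -> set 'cV[R]_n.

Implicit Types T A B : setop.

Definition gph T : set ('cV[R]_n * 'cV[R]_n) := [set p | T p.1 p.2].

Definition zer T : set 'cV[R]_n := [set x | T x 0].

Definition dom T : set 'cV[R]_n := [set x | T x !=set0].

Definition osc T : Prop := closed (gph T).

Definition op_id : setop := fun x => [set x].

Definition op_inv T : setop := fun y => [set x | T x y].

Definition op_add A B : setop := fun x => [set a + b | a in A x & b in B x].

Definition op_scale (c : R) A : setop := fun x => [set c *: a | a in A x].

Definition resolvent A : setop := op_inv (op_add op_id A).

(* Continuity is relative to the domain, so that T need not be everywhere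
   defined. *)
Definition single_valued_continuous T : Prop :=
  exists f : 'cV[R]_n -> 'cV[R]_n,
    (forall x, dom T x -> T x = [set f x]) /\ {within dom T, continuous f}.

Definition semimonotone_at (mu rho : R) A (p : 'cV[R]_n * 'cV[R]_n) : Prop :=
  gph A p /\
  forall q, gph A q ->
    mu * enorm (q.1 - p.1) ^+ 2 + rho * enorm (q.2 - p.2) ^+ 2
      <= dot (q.1 - p.1) (q.2 - p.2).

Definition semimonotone (mu rho : R) A : Prop :=
  forall p, gph A p -> semimonotone_at mu rho A p.

Definition max_semimonotone (mu rho : R) A : Prop :=
  semimonotone mu rho A /\
  ~ exists A' : setop, semimonotone mu rho A' /\ gph A `<` gph A'.

End SetValuedOperators.

(* The case a + b = 0 with a != 0 is excluded in all uses; the value there is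
   the conventional a * b / 0 = 0. *)
Definition parsum (R : realType) (a b : R) : R :=
  if (a == 0) && (b == 0) then 0 else a * b / (a + b).

Definition neg_part (R : realType) (t : R) : R := Num.min 0 t.

Definition assumption_P (R : realType) (muA rhoA muB rhoB : R) : Prop :=
  [/\ 0 < muA + muB \/ (muA = 0 /\ muB = 0),
      0 < rhoA + rhoB \/ (rhoA = 0 /\ rhoB = 0)
    & neg_part (parsum muA muB) * neg_part (parsum rhoA rhoB) < 4^-1].

Section Stepsize.
Variables (R : realType) (muA rhoA muB rhoB : R).

Let mu : R := parsum muA muB.
Let rho : R := parsum rhoA rhoB.

Definition gamma_minus : R :=
  - ((2 * rho) / (1 + Num.sqrt (1 - 4 * mu * rho))).

Definition gamma_plus : R :=
  - ((1 + Num.sqrt (1 - 4 * mu * rho)) / (2 * mu)).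

Let mu_zero : Prop := muA = 0 /\ muB = 0.
Let mu_same : Prop := 0 < muA + muB /\ 0 <= muA * muB.
Let mu_opp : Prop := 0 < muA + muB /\ muA * muB < 0.
Let rho_zero : Prop := rhoA = 0 /\ rhoB = 0.
Let rho_same : Prop := 0 < rhoA + rhoB /\ 0 <= rhoA * rhoB.
Let rho_opp : Prop := 0 < rhoA + rhoB /\ rhoA * rhoB < 0.

Definition stepsize_range (gamma : R) : Prop :=
     (rho_zero /\ (mu_zero \/ mu_same) /\ gamma \in `]0, +oo[)
  \/ (rho_zero /\ mu_opp /\ gamma \in `]0, - mu^-1[)
  \/ (rho_same /\ (mu_zero \/ mu_same) /\ gamma \in `]0, +oo[)
  \/ (rho_same /\ mu_opp /\ gamma \in `]0, gamma_plus[)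
  \/ (rho_opp /\ mu_zero /\ gamma \in `](- rho), +oo[)
  \/ (rho_opp /\ mu_same /\ gamma \in `]gamma_minus, +oo[)
  \/ (rho_opp /\ mu_opp /\ gamma \in `]gamma_minus, gamma_plus[).

End Stepsize.

Section PrimalDual.
Variables (R : realType) (n : nat).
Implicit Types A B : setop R n.

(* A pair (x, y) is represented by the block column col_mx x y. *)
Definition T_PD A B : setop R (n + n) := fun z =>
  [set col_mx (a + dsubmx z) (b - usubmx z)
    | a in A (usubmx z) & b in op_inv B (dsubmx z)].

(* The set of all x - gamma * y for (x, y) in S. *)
Definition s_set (gamma : R) (S : set 'cV[R]_(n + n)) : set 'cV[R]_n :=
  [set usubmx z - gamma *: dsubmx z | z in S].

Definition hyp_a A B (muA rhoA muB rhoB gamma : R)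
    (S : set 'cV[R]_(n + n)) : Prop :=
  osc A /\ osc B /\
  dom (resolvent (op_scale gamma A)) = setT /\
  dom (resolvent (op_scale gamma B)) = setT /\
  S !=set0 /\ S `<=` zer (T_PD A B) /\
  forall x y : 'cV[R]_n, S (col_mx x y) ->
    semimonotone_at muA rhoA A (x, - y) /\ semimonotone_at muB rhoB B (x, y).

Definition hyp_b A B (muA rhoA muB rhoB : R) : Prop :=
  zer (op_add A B) !=set0 /\
  max_semimonotone muA rhoA A /\ max_semimonotone muB rhoB B.

Definition DRS A B (gamma : R) (lam : nat -> R) (u v s : nat -> 'cV[R]_n)
    : Prop :=
  forall k : nat,
    [/\ resolvent (op_scale gamma A) (s k) (u k),
        resolvent (op_scale gamma B) (2 *: u k - s k) (v k)
      & s k.+1 = s k + lam k *: (v k - u k)].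

Definition pd_seq (gamma : R) (u s : nat -> 'cV[R]_n)
    : nat -> 'cV[R]_(n + n) :=
  fun k => col_mx (u k) (gamma^-1 *: (u k - s k)).

End PrimalDual.

(* When L is a linear subspace, there is exactly one such point p. *)
Definition orth_proj (R : realType) (m : nat) (L : set 'cV[R]_m)
    (z : 'cV[R]_m) : 'cV[R]_m :=
  xget 0 [set p | L p /\ forall w, L w -> dot (z - p) w = 0].

Definition Pi_proj (R : realType) (n : nat) (gamma : R)
    : 'cV[R]_(n + n) -> 'cV[R]_(n + n) :=
  orth_proj (range (mulmx (block_mx (gamma^-1)%:M (- 1%:M)
                                    (- 1%:M) gamma%:M : 'M[R]_(n + n)))).

(* Main.v *)
Require Import Defs.
From mathcomp Require Import all_boot all_order all_algebra.
From mathcomp Require Import all_classical all_reals all_analysis.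
From mathcomp Require Import ring lra.

Set Implicit Arguments.
Unset Strict Implicit.
Unset Printing Implicit Defensive.

Import Order.TTheory GRing.Theory Num.Theory.
Import numFieldNormedType.Exports.

Local Open Scope classical_set_scope.
Local Open Scope ring_scope.

(** Write w_k = u_k - v_k, and let (x, y) be a primal-dual solution at which A
    and B are semimonotone. Adding the two semimonotonicity inequalities and
    bounding the quadratic terms below by parallel sums
    ([parsum_dot_le]) gives, with t = x - gamma y,

      alpha |w_k|^2 <= <w_k, s_k - t>.

    Since s_{k+1} = s_k - lam_k w_k, the squared distance from s_k to t drops at
    step k by at least lam_k (2 alpha - lam_k) |w_k|^2 ([fejer_step]). So s is
    Fejer monotone with respect to every such t, w_k tends to zero, and summing
    bounds the smallest residual. The stepsize range is exactly what makes
    alpha positive: its positive endpoints are roots of gamma alpha, which is a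
    quadratic in gamma ([stepsize_range_pos]).

    Limit points come from closedness of the graphs. When u and s converge
    along a subsequence, so does v because w_k tends to zero, and the limit
    solves the primal-dual inclusion ([DRS_limit_zer]). Such subsequences exist
    along every convergent subsequence of s because u is bounded too: a parallel
    sum is at most each of its arguments, so the positivity of alpha bounds
    |u_k - x| by a multiple of |s_k - t| ([resolvent_growth]).

    The projection of (x, y) carries the same information as x - gamma y
    ([Pi_proj_shadow]). When the two projected sets agree, every limit point
    of s is therefore one of the points t above, and a Fejer monotone sequence
    converges to a limit point of this kind. Continuity of the resolvent of A
    at that limit then gives convergence of u.

    If A and B are maximally semimonotone, their graphs are closed
    ([max_semimonotone_osc]), and the inequality displayed above holds for the
    difference of any two steps. Applied to consecutive ones it shows that
    |w_k| is nonincreasing. A nonincreasing sequence whose terms are bounded by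
    the increments of a convergent one is o(1/(N+1))
    ([telescoping_little_o]). *)

(** * The Euclidean inner product *)

Section Dot.
Variables (R : realType) (n : nat).
Implicit Types x y z : 'cV[R]_n.

Lemma dotC x y : dot x y = dot y x.
Proof. by apply: eq_bigr => i _; rewrite mulrC. Qed.

Lemma dotDl x y z : dot (x + y) z = dot x z + dot y z.
Proof. by rewrite -big_split; apply: eq_bigr => i _; rewrite mxE mulrDl. Qed.

Lemma dotDr x y z : dot z (x + y) = dot z x + dot z y.
Proof. by rewrite dotC dotDl !(dotC z). Qed.

Lemma dotZl c x z : dot (c *: x) z = c * dot x z.
Proof. by rewrite big_distrr; apply: eq_bigr => i _; rewrite mxE -mulrA. Qed.

Lemma dotZr c x z : dot z (c *: x) = c * dot z x.
Proof. by rewrite dotC dotZl (dotC z). Qed.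

Lemma dotNl x z : dot (- x) z = - dot x z.
Proof. by rewrite -scaleN1r dotZl mulN1r. Qed.

Lemma dotNr x z : dot z (- x) = - dot z x.
Proof. by rewrite dotC dotNl (dotC z). Qed.

Definition dotE := (dotDl, dotDr, dotNl, dotNr, dotZl, dotZr).

Lemma dotxx_ge0 x : 0 <= dot x x.
Proof. by apply: sumr_ge0 => i _; rewrite -expr2 sqr_ge0. Qed.

Lemma sqr_enorm x : enorm x ^+ 2 = dot x x.
Proof. by rewrite sqr_sqrtr ?dotxx_ge0. Qed.

Lemma sqr_coord_le_dot x i : x i ord0 ^+ 2 <= dot x x.
Proof.
rewrite /dot (bigD1 i) //= -expr2 lerDl.
by apply: sumr_ge0 => j _; rewrite -expr2 sqr_ge0.
Qed.

End Dot.

(** * Parallel sums and the range of the stepsize *)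

Section ParallelSum.
Variable R : realType.
Implicit Types a b : R.

Lemma parsum_le_left a b : 0 < a + b \/ (a = 0 /\ b = 0) -> parsum a b <= a.
Proof.
case=> [ab0|[-> ->]]; rewrite /parsum ?eqxx //=.
case: ifP => [/andP[/eqP -> _]|_]; first by [].
by rewrite ler_pdivrMr // mulrDr lerDr -expr2 sqr_ge0.
Qed.

(** Multiplied by a + b, the difference of the two sides is the squared norm of
    a x - b y. *)
Lemma parsum_dot_le n a b (x y : 'cV[R]_n) :
  0 < a + b \/ (a = 0 /\ b = 0) ->
  parsum a b * dot (x + y) (x + y) <= a * dot x x + b * dot y y.
Proof.
case=> [ab0|[-> ->]]; rewrite /parsum ?eqxx //=; last by rewrite !mul0r addr0.
case: ifP => [/andP[/eqP -> /eqP ->]|_]; first by rewrite !mul0r addr0.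
rewrite mulrAC ler_pdivrMr // -subr_ge0.
have := dotxx_ge0 (a *: x - b *: y).
rewrite !dotE (dotC y x) => h; lra.
Qed.

Lemma parsum_ge0 a b : 0 < a + b -> 0 <= a * b -> 0 <= parsum a b.
Proof. by move=> ? ?; rewrite /parsum; case: ifP => // _; rewrite divr_ge0 // ltW. Qed.

Lemma parsum_lt0 a b : 0 < a + b -> a * b < 0 -> parsum a b < 0.
Proof.
move=> ab0 abN; rewrite /parsum; case: ifP => [/andP[/eqP a0 _]|_].
  by move: abN; rewrite a0 mul0r ltxx.
by rewrite pmulr_llt0 ?invr_gt0.
Qed.

Lemma parsum00 : parsum 0 0 = 0 :> R.
Proof. by rewrite /parsum eqxx. Qed.

End ParallelSum.

Section Stepsize.
Variable R : realType.
Implicit Types mu rho gamma : R.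

(** With d the square root of the discriminant, the quadratic
    mu g^2 + g + rho, multiplied by 2 (1 + d), is the product of two linear forms
    whose roots are the endpoints of the stepsize interval. Unlike the usual
    factorization this one does not divide by mu or rho. *)
Lemma quadratic_pos_of_factors mu rho gamma (d := Num.sqrt (1 - 4 * mu * rho)) :
  0 <= 1 - 4 * mu * rho ->
  0 < gamma * (1 + d) + 2 * rho -> 0 < 1 + d + 2 * mu * gamma ->
  0 < gamma + rho + gamma ^+ 2 * mu.
Proof.
move=> disc h1 h2.
have d0 : 0 <= d by exact: sqrtr_ge0.
have d2 : d ^+ 2 = 1 - 4 * mu * rho by rewrite sqr_sqrtr.
have d1 : 0 < 2 * (1 + d) by lra.
rewrite -(pmulr_rgt0 _ d1).
suff -> : 2 * (1 + d) * (gamma + rho + gamma ^+ 2 * mu) =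
  (gamma * (1 + d) + 2 * rho) * (1 + d + 2 * mu * gamma) by exact: mulr_gt0.
have -> : (gamma * (1 + d) + 2 * rho) * (1 + d + 2 * mu * gamma) =
  gamma * (1 + 2 * d + d ^+ 2 + 4 * mu * rho) +
  2 * (1 + d) * (mu * gamma ^+ 2 + rho) by ring.
rewrite d2; ring.
Qed.

Lemma quadratic_pos_of_ge0 mu rho gamma : 0 < gamma -> 0 <= rho -> 0 <= mu ->
  0 < gamma + rho + gamma ^+ 2 * mu.
Proof. by move=> *; rewrite !ltr_wpDr // mulr_ge0 // sqr_ge0. Qed.

Lemma gamma_plus_factor mu d gamma : mu < 0 ->
  gamma < - ((1 + d) / (2 * mu)) -> 0 < 1 + d + 2 * mu * gamma.
Proof.
move=> m; have m2 : 0 < - (2 * mu) by lra.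
by rewrite -mulrN -invrN ltr_pdivlMr // => ?; lra.
Qed.

Lemma gamma_minus_factor rho d gamma : 0 <= d ->
  - (2 * rho / (1 + d)) < gamma -> 0 < gamma * (1 + d) + 2 * rho.
Proof.
move=> d0; have d1 : 0 < 1 + d by lra.
by rewrite -mulNr ltr_pdivrMr // => ?; lra.
Qed.

Lemma gamma_minus_pos rho d gamma : 0 <= d -> rho < 0 ->
  - (2 * rho / (1 + d)) < gamma -> 0 < gamma.
Proof.
by move=> d0 r; apply: le_lt_trans; rewrite -mulNr divr_ge0 //; lra.
Qed.

(** The right-hand quadratic is gamma alpha. Wherever gamma_minus or gamma_plus
    bounds gamma, that bound is the positivity of one of the two linear factors,
    and the signs of the parallel sums give the other factor if it is not
    bounded likewise. *)
Lemma stepsize_range_pos muA rhoA muB rhoB gamma :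
  assumption_P muA rhoA muB rhoB -> stepsize_range muA rhoA muB rhoB gamma ->
  0 < gamma /\ 0 < gamma + parsum rhoA rhoB + gamma ^+ 2 * parsum muA muB.
Proof.
case=> _ _; rewrite /stepsize_range /gamma_plus /gamma_minus.
have mu_ge0 : (muA = 0 /\ muB = 0) \/ (0 < muA + muB /\ 0 <= muA * muB) ->
    0 <= parsum muA muB.
  by move=> [[-> ->]|[? ?]]; [rewrite parsum00|exact: parsum_ge0].
have mu_lt0 : 0 < muA + muB /\ muA * muB < 0 -> parsum muA muB < 0.
  by move=> [? ?]; exact: parsum_lt0.
have rho_ge0 : 0 < rhoA + rhoB /\ 0 <= rhoA * rhoB -> 0 <= parsum rhoA rhoB.
  by move=> [? ?]; exact: parsum_ge0.
have rho_eq0 : rhoA = 0 /\ rhoB = 0 -> parsum rhoA rhoB = 0.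
  by move=> [-> ->]; rewrite parsum00.
have rho_lt0 : 0 < rhoA + rhoB /\ rhoA * rhoB < 0 -> parsum rhoA rhoB < 0.
  by move=> [? ?]; exact: parsum_lt0.
move: (parsum muA muB) (parsum rhoA rhoB) mu_ge0 mu_lt0 rho_ge0 rho_eq0 rho_lt0.
move=> mu rho mu_ge0 mu_lt0 rho_ge0 rho_eq0 rho_lt0 disc.
have factors := @quadratic_pos_of_factors mu rho gamma.
have := sqrtr_ge0 (1 - 4 * mu * rho).
move: (Num.sqrt _) factors => d factors d0.
move=> [[/rho_eq0 r0 [/mu_ge0 m]]|[[/rho_eq0 r0 [/mu_lt0 m]]|
  [[/rho_ge0 r [/mu_ge0 m]]|[[/rho_ge0 r [/mu_lt0 m]]|
  [[/rho_lt0 r [m]]|[[/rho_lt0 r [m]]|[/rho_lt0 r [/mu_lt0 m]]]]]]]];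
  rewrite in_itv /= ?andbT; clear rho_eq0 rho_lt0 rho_ge0 mu_lt0.
- by move=> g0; split=> //; apply: quadratic_pos_of_ge0; rewrite ?r0.
- move=> /andP[g0 g1]; split=> //; rewrite r0 addr0 expr2 -mulrA.
  rewrite -[X in X + _]mulr1 -mulrDr mulr_gt0 //.
  move: g1; rewrite -invrN -(mul1r (- mu)^-1) ltr_pdivlMr ?oppr_gt0 // => g1.
  by clear -g1; lra.
- by move=> g0; split=> //; exact: quadratic_pos_of_ge0.
- move=> /andP[g0 /(gamma_plus_factor m) g1]; split=> //; apply: factors => //.
    by rewrite subr_ge0 (le_trans _ ler01) // mulr_le0_ge0 // nmulr_lle0.
  by rewrite ltr_wpDr ?mulr_ge0 // mulr_gt0 // ltr_wpDr.
- move=> g1; have g0 : 0 < gamma by apply: lt_trans g1; rewrite oppr_gt0.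
  have {mu_ge0}m0 : 0 <= mu by apply: mu_ge0; left.
  split=> //; apply: ltr_wpDr; first by rewrite mulr_ge0 // sqr_ge0.
  by rewrite addrC -ltrBlDl sub0r.
- move=> g1; have g0 := gamma_minus_pos d0 r g1.
  have {mu_ge0}m0 : 0 <= mu by apply: mu_ge0; right.
  split=> //; apply: factors.
  + rewrite subr_ge0 (le_trans _ ler01) // mulr_ge0_le0 ?mulr_ge0 //.
    exact: ltW.
  + exact: gamma_minus_factor.
  + by rewrite ltr_wpDr ?ltr_pwDl // !mulr_ge0 // ltW.
- move=> /andP[g1 /(gamma_plus_factor m) g2].
  split; first exact: gamma_minus_pos g1.
  apply: factors => //; last exact: gamma_minus_factor.
  move: disc; rewrite /neg_part (min_r (ltW m)) (min_r (ltW r)) => disc.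
  clear -disc; lra.
Qed.

End Stepsize.

(** * Sequences of vectors: convergence, cluster points, compactness *)

Section MatrixSequences.
Variable R : realType.

Lemma mx_cvg (T : Type) (F : set_system T) {FF : Filter F} m n
    (f : T -> 'M[R]_(m, n)) (l : 'M[R]_(m, n)) :
  (forall i j, (fun t => f t i j) @ F --> l i j) -> f @ F --> l.
Proof.
move=> fl A [P lP sPA]; rewrite /= /nbhs /=.
have : \forall t \near F, forall ij : 'I_m * 'I_n,
    P ij.1 ij.2 (f t ij.1 ij.2).
  by apply: filter_forall => ij; apply: (fl ij.1 ij.2); exact: lP.
by apply: filterS => t Pt; apply: sPA => i j; exact: (Pt (i, j)).
Qed.

Lemma cvg_coord (T : Type) (F : set_system T) {FF : Filter F} m n
    (f : T -> 'M[R]_(m, n)) (l : 'M[R]_(m, n)) i j :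
  f @ F --> l -> (fun t => f t i j) @ F --> l i j.
Proof.
move=> fl.
exact: (@cvg_comp _ _ _ f (fun M => M i j) _ _ _ fl (@coord_continuous _ m n i j l)).
Qed.

Lemma cvg_usubmx (T : Type) (F : set_system T) {FF : Filter F} m1 m2 n
    (f : T -> 'M[R]_(m1 + m2, n)) (l : 'M[R]_(m1 + m2, n)) :
  f @ F --> l -> (fun t => usubmx (f t)) @ F --> usubmx l.
Proof.
move=> fl; apply: mx_cvg => i j; rewrite mxE.
by under eq_fun do rewrite mxE; exact: cvg_coord.
Qed.

Lemma cvg_dsubmx (T : Type) (F : set_system T) {FF : Filter F} m1 m2 n
    (f : T -> 'M[R]_(m1 + m2, n)) (l : 'M[R]_(m1 + m2, n)) :
  f @ F --> l -> (fun t => dsubmx (f t)) @ F --> dsubmx l.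
Proof.
move=> fl; apply: mx_cvg => i j; rewrite mxE.
by under eq_fun do rewrite mxE; exact: cvg_coord.
Qed.

Lemma cvg_col_mx (T : Type) (F : set_system T) {FF : Filter F} m1 m2 n
    (f : T -> 'M[R]_(m1, n)) (g : T -> 'M[R]_(m2, n))
    (a : 'M[R]_(m1, n)) (b : 'M[R]_(m2, n)) :
  f @ F --> a -> g @ F --> b ->
  (fun t => col_mx (f t) (g t)) @ F --> col_mx a b.
Proof.
move=> fa gb; apply: mx_cvg => i j; rewrite mxE.
under eq_fun do rewrite mxE.
by case: (fintype.split i) => k; exact: cvg_coord.
Qed.

Lemma cvg_dot (T : Type) (F : set_system T) {FF : Filter F} n
    (f g : T -> 'cV[R]_n) (a b : 'cV[R]_n) :
  f @ F --> a -> g @ F --> b -> (fun t => dot (f t) (g t)) @ F --> dot a b.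
Proof.
move=> fa gb; apply: cvg_big => [|i _]; first exact: add_continuous.
by apply: cvgM; exact: cvg_coord.
Qed.

Lemma cvg_of_dot_cvg0 (T : Type) (F : set_system T) {FF : Filter F} n
    (f : T -> 'cV[R]_n) (l : 'cV[R]_n) :
  (fun t => dot (f t - l) (f t - l)) @ F --> (0 : R) -> f @ F --> l.
Proof.
move=> /cvgrPdist_lt h; apply: mx_cvg => i j; rewrite (ord1 j).
apply/cvgrPdist_lt => e e0; apply: filterS (h _ (exprn_gt0 2 e0)) => t.
rewrite sub0r normrN ger0_norm ?dotxx_ge0 // => ht.
rewrite -(ltr_pXn2r (n := 2)) ?nnegrE ?(ltW e0) // distrC.
apply: le_lt_trans ht; rewrite real_normK ?num_real //.
by have := sqr_coord_le_dot (f t - l) i; rewrite !mxE.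
Qed.

Lemma cvg_unbounded (phi : nat -> nat) :
  (forall j, (j <= phi j)%N) -> phi @ \oo --> \oo.
Proof.
move=> hphi A [N _ sA]; exists N => // k /= Nk.
by apply: sA => /=; exact: leq_trans (hphi k).
Qed.

Lemma cvg_subseq (T : topologicalType) (x : nat -> T) (l : T) (phi : nat -> nat) :
  (forall j, (j <= phi j)%N) -> x @ \oo --> l -> (x \o phi) @ \oo --> l.
Proof. by move=> /cvg_unbounded hphi xl; exact: cvg_comp hphi xl. Qed.

(** The extraction phi is only asked to dominate the identity: that suffices to
    pass to limits and is stable under composition. *)
Lemma cluster_subseq (T : pseudoMetricType R) (x : nat -> T) (l : T) :
  cluster (x @ \oo) l ->
  exists2 phi : nat -> nat, (forall j, (j <= phi j)%N) & (x \o phi) @ \oo --> l.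
Proof.
move=> hl.
have /choice[phi hphi] : forall j, exists k : nat,
    (j <= k)%N /\ ball l (j.+1%:R^-1) (x k).
  move=> j.
  have tail : (x @ \oo) [set x k | k in [set k | (j <= k)%N]].
    by exists j => // k /= jk; exists k.
  have [|_ [[k jk <-] bk]] := hl _ (ball l (j.+1%:R^-1 : R)) tail.
    by apply: nbhsx_ballx; rewrite invr_gt0.
  by exists k.
exists phi => [j|]; first by have [] := hphi j.
apply/cvg_ballP => e e0.
near=> j; apply: le_ball (hphi j).2.
by apply: ltW; near: j; exact: (near_infty_natSinv_lt (PosNum e0)).
Unshelve. all: by end_near. Qed.

Lemma cV_box_compact n (M : R) :
  compact [set x : 'cV[R]_n | forall i, `|x i ord0| <= M].
Proof.
have := rV_compact (fun _ : 'I_n => @segment_compact R (- M) M).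
set K := (X in compact X) => cK.
have ct : {within K, continuous (fun v : 'rV[R]_n => v^T)}.
  apply: continuous_subspaceT => v.
  apply: (mx_cvg (FF := nbhs_filter v)) => i j; rewrite mxE.
  by under eq_fun do rewrite mxE; exact: coord_continuous.
have := continuous_compact ct cK; congr compact.
rewrite eqEsubset; split=> [_ [v Kv <-] i|x hx] /=.
  by rewrite mxE ler_norml; have := Kv i; rewrite /= in_itv.
exists x^T; last by rewrite trmxK.
by move=> i; rewrite /= mxE in_itv /= -ler_norml.
Qed.

(** Bolzano-Weierstrass, for the Euclidean norm. *)
Lemma bounded_subseq n (x : nat -> 'cV[R]_n) (M : R) :
  (forall k, dot (x k) (x k) <= M) ->
  exists l : 'cV[R]_n, exists2 phi : nat -> nat,
    (forall j, (j <= phi j)%N) & (x \o phi) @ \oo --> l.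
Proof.
move=> xM.
have [|l [_ hl]] := @cV_box_compact n (Num.sqrt M) (x @ \oo) _.
  exists 0%N => // k _ i /=; rewrite -sqrtr_sqr ler_wsqrtr //.
  exact: le_trans (sqr_coord_le_dot _ _) (xM k).
by exists l; exact: cluster_subseq.
Qed.

Lemma bounded_fun_of_dot n (x : nat -> 'cV[R]_n) (M : R) :
  (forall k, dot (x k) (x k) <= M) -> bounded_fun x.
Proof.
move=> xM; exists (Num.sqrt M); split; first exact: num_real.
move=> y My k _ /=; rewrite [leLHS]/Num.norm /= mx_normrE; apply/bigmax_leP; split.
  by apply: le_trans (ltW My); exact: sqrtr_ge0.
move=> [i j] _ /=; rewrite (ord1 j); apply: le_trans (ltW My).
rewrite -sqrtr_sqr ler_wsqrtr //.
exact: le_trans (sqr_coord_le_dot _ _) (xM k).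
Qed.

End MatrixSequences.

Lemma cvg_nonincreasing (R : realType) (D : nat -> R) :
  (forall k, 0 <= D k) -> (forall k, D k.+1 <= D k) -> cvgn D.
Proof.
move=> D0 Dle; apply: nonincreasing_is_cvgn.
  by apply/nonincreasing_seqP.
by exists 0 => _ [k _ <-].
Qed.

(** The upper bound M makes the sequence of infima of tails converge, so that
    its limit is a genuine one. *)
Lemma limn_inf_gt0_near (R : realType) (f : nat -> R) (M : R) :
  (forall k, 0 <= f k <= M) -> 0 < limn_inf f ->
  exists2 c, 0 < c & \forall k \near \oo, c <= f k.
Proof.
move=> fM h.
have lbf : has_lbound (range f) by exists 0 => _ [k _ <-]; case/andP: (fM k).
have ubf : has_ubound (range f) by exists M => _ [k _ <-]; case/andP: (fM k).
have cf : cvgn (infs f) by apply/cvg_ex; eexists; exact: cvg_infs_sup.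
exists (limn_inf f / 2); first by rewrite divr_gt0.
have /cvgrPdist_lt/(_ (limn_inf f / 2)) : infs f @ \oo --> limn_inf f := cf.
move=> /(_ (divr_gt0 h (ltr0Sn _ 1))).
apply: filterS => k; rewrite ltr_norml => /andP[_ hk].
apply: (@le_trans _ _ (infs f k)); first by rewrite /=; lra.
by apply: ge_inf; [exact: has_lbound_sdrop|exists k => /=].
Qed.

(** * Semimonotone operators *)

Section Operators.
Variables (R : realType) (n : nat).
Implicit Types A B : setop R n.

Lemma resolvent_scaleP A (gamma : R) s u : gamma != 0 ->
  resolvent (op_scale gamma A) s u <-> A u (gamma^-1 *: (s - u)).
Proof.
move=> g0; split=> [[_ -> [_ [a Aa <-] <-]]|Aa].
  by rewrite addrC addKr scalerA mulVf // scale1r.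
exists u => //; exists (s - u); last by rewrite addrC subrK.
by exists (gamma^-1 *: (s - u)) => //; rewrite scalerA mulfV // scale1r.
Qed.

Lemma zer_T_PD_col_mx A B x y :
  zer (T_PD A B) (col_mx x y) <-> A x (- y) /\ B x y.
Proof.
rewrite /zer /T_PD /= /op_inv /= col_mxKu col_mxKd; split.
  move=> [a Aa [b Bb]]; rewrite -col_mx0 => /eq_col_mx[/eqP ay /eqP bx].
  move: ay bx; rewrite addr_eq0 subr_eq0 => /eqP <- /eqP bx.
  by split=> //; rewrite -{1}bx.
move=> [Ax Bx]; exists (- y) => //; exists x => //.
by rewrite addNr subrr col_mx0.
Qed.

Lemma zer_T_PD_neq0 A B :
  zer (op_add A B) !=set0 -> zer (T_PD A B) !=set0.
Proof.
move=> [x [a Aa [b Bb]]] /eqP; rewrite addr_eq0 => /eqP ab.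
by exists (col_mx x b); apply/zer_T_PD_col_mx; rewrite -ab.
Qed.

Lemma osc_seq_limit A (F : nat -> 'cV[R]_n) (G : nat -> 'cV[R]_n) x y :
  osc A -> (forall k, A (F k) (G k)) ->
  F @ \oo --> x -> G @ \oo --> y -> A x y.
Proof.
move=> clA AFG Fx Gy.
apply: (@closed_cvg _ _ \oo _ (fun k => (F k, G k)) (gph A) clA _ (x, y)).
  by apply: nearW => k; exact: AFG.
exact: (@cvg_pair _ _ _ \oo (nbhs x) (nbhs y) _ _ _ F G Fx Gy).
Qed.

(** A maximally semimonotone operator has a closed graph because the
    semimonotonicity inequality survives the passage to the closure of the
    graph, which is then the graph of a semimonotone extension. *)
Lemma max_semimonotone_osc mu rho A : max_semimonotone mu rho A -> osc A.
Proof.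
move=> [smA maxA]; pose A' : setop R n := fun x => [set y | closure (gph A) (x, y)].
pose gap (p q : 'cV[R]_n * 'cV[R]_n) : R := dot (q.1 - p.1) (q.2 - p.2) -
  (mu * dot (q.1 - p.1) (q.1 - p.1) + rho * dot (q.2 - p.2) (q.2 - p.2)).
have gapC p q : gap p q = gap q p.
  by rewrite /gap !dotE; ring.
have gap_closed p : closed [set q | 0 <= gap p q].
  apply: (preimage_closed (f := gap p) (D := [set t : R | 0 <= t])); last first.
    exact: closed_ge.
  move=> q _; have d1 : (r.1 - p.1) @[r --> q] --> q.1 - p.1.
    by apply: cvgB; [exact: cvg_fst|exact: cvg_cst].
  have d2 : (r.2 - p.2) @[r --> q] --> q.2 - p.2.
    by apply: cvgB; [exact: cvg_snd|exact: cvg_cst].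
  exact: (cvgB (cvg_dot d1 d2) (cvgD (cvgM (cvg_cst mu) (cvg_dot d1 d1))
    (cvgM (cvg_cst rho) (cvg_dot d2 d2)))).
have gap_ge0 p q : closure (gph A) p -> closure (gph A) q -> 0 <= gap p q.
  have sub (C : set ('cV[R]_n * 'cV[R]_n)) : closed C -> gph A `<=` C ->
      closure (gph A) `<=` C.
    by move=> clC AC q' /(closureS AC); exact: clC.
  move=> clp clq; rewrite gapC; apply: (sub _ (gap_closed q)) clp => p' Ap'.
  rewrite /= gapC; apply: (sub _ (gap_closed p')) clq => q' Aq'.
  by have := (smA p' Ap').2 q' Aq'; rewrite /= !sqr_enorm -subr_ge0.
apply: contrapT => nclA; apply: maxA; exists A'; split.
  move=> p A'p; split=> // q A'q.
  rewrite !sqr_enorm -subr_ge0; apply: gap_ge0.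
    by case: p A'p.
  by case: q A'q.
split; first by move=> [x y] Axy; exact: subset_closure.
by move=> sub; apply: nclA => -[x y]; exact: sub.
Qed.

(** Reduces the maximal case to closed graphs and semimonotonicity at every
    primal-dual solution. *)
Lemma hyp_b_regular A B muA rhoA muB rhoB : hyp_b A B muA rhoA muB rhoB ->
  [/\ osc A, osc B, zer (T_PD A B) !=set0 &
    forall x y, zer (T_PD A B) (col_mx x y) ->
      semimonotone_at muA rhoA A (x, - y) /\ semimonotone_at muB rhoB B (x, y)].
Proof.
move=> [z0 [mA mB]]; split.
- exact: max_semimonotone_osc mA.
- exact: max_semimonotone_osc mB.
- exact: zer_T_PD_neq0.
- by move=> x y /zer_T_PD_col_mx[Ax Bx]; split; [apply: mA.1|apply: mB.1].
Qed.

End Operators.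

(** * The two basic estimates of a Douglas-Rachford step *)

Section Step.
Variables (R : realType) (n : nat) (A B : setop R n).
Variables (muA rhoA muB rhoB gamma : R).
Hypothesis gamma_gt0 : 0 < gamma.
Hypothesis hmu : 0 < muA + muB \/ (muA = 0 /\ muB = 0).
Hypothesis hrho : 0 < rhoA + rhoB \/ (rhoA = 0 /\ rhoB = 0).
Let alpha := 1 + gamma^-1 * parsum rhoA rhoB + gamma * parsum muA muB.

(** The points p + gamma q and p' + gamma q' are the displacements of the
    arguments of the two resolvents. The cross terms combine because the second
    argument is the reflection of the first. *)
Lemma semimonotone_sum_le (p p' q q' : 'cV[R]_n) :
  muA * dot p p + rhoA * dot q q <= dot p q ->
  muB * dot p' p' + rhoB * dot q' q' <= dot p' q' ->
  q + q' = gamma^-1 *: (p - p') ->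
  alpha * dot (p - p') (p - p') <= dot (p - p') (p + gamma *: q).
Proof.
move=> hA hB qq'; have HM := parsum_dot_le p (- p') hmu.
have HR := parsum_dot_le q q' hrho.
have q'E : q' = gamma^-1 *: (p - p') - q by rewrite -qq' addrAC subrr add0r.
have g0 : gamma != 0 by rewrite gt_eqF.
set W := dot (p - p') (p - p') in HM *.
have ip : gamma * (dot p q + dot p' q') = dot (p - p') (p + gamma *: q) - W.
  rewrite /W q'E !dotE (dotC p' p); field.
  exact: g0.
rewrite qq' dotZl dotZr -/W in HR.
have HM' : parsum muA muB * W <= muA * dot p p + muB * dot p' p'.
  by move: HM; rewrite dotNl dotNr opprK.
have := ler_pM2l gamma_gt0 (parsum muA muB * W +
  parsum rhoA rhoB * (gamma^-1 * (gamma^-1 * W))) (dot p q + dot p' q').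
rewrite ip => key.
have : gamma * (parsum muA muB * W + parsum rhoA rhoB * (gamma^-1 * (gamma^-1 * W)))
   <= dot (p - p') (p + gamma *: q) - W by rewrite key; lra.
have -> : gamma * (parsum muA muB * W + parsum rhoA rhoB * (gamma^-1 * (gamma^-1 * W)))
  = alpha * W - W by rewrite /alpha; field; exact: g0.
lra.
Qed.

(** Seen as a function of s, the residual u - v satisfies the alpha-cocoercivity
    inequality at every step (s', u', v') through points of semimonotonicity.
    For a primal-dual solution (x, y) that step is (x - gamma y, x, x), with zero
    residual; under semimonotonicity everywhere it may be another iterate. *)
Lemma residual_cocoercive (s u v s' u' v' : 'cV[R]_n) :
  semimonotone_at muA rhoA A (u', gamma^-1 *: (s' - u')) ->
  semimonotone_at muB rhoB B (v', gamma^-1 *: (2 *: u' - s' - v')) ->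
  A u (gamma^-1 *: (s - u)) -> B v (gamma^-1 *: (2 *: u - s - v)) ->
  alpha * dot (u - v - (u' - v')) (u - v - (u' - v'))
    <= dot (u - v - (u' - v')) (s - s').
Proof.
move=> [_ hA] [_ hB] Au Bv.
have g0 : gamma != 0 by rewrite gt_eqF.
have := hA (u, gamma^-1 *: (s - u)) Au.
have := hB (v, gamma^-1 *: (2 *: u - s - v)) Bv.
rewrite !sqr_enorm /= => hB' hA'.
have := semimonotone_sum_le hA' hB' _.
have -> : u - u' - (v - v') = u - v - (u' - v').
  by apply/colP => i; rewrite !mxE; ring.
have -> : u - u' + gamma *: (gamma^-1 *: (s - u) - gamma^-1 *: (s' - u')) = s - s'.
  by apply/colP => i; rewrite !mxE; field.
by apply; apply/colP => i; rewrite !mxE; ring.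
Qed.

(** For a single reference point the resolvent of A still has linear growth: the
    semimonotonicity inequality is a quadratic inequality in u - u' with leading
    coefficient gamma + rhoA + gamma^2 muA, which is at least gamma alpha since a
    parallel sum is at most each of its arguments. *)
Lemma resolvent_growth : 0 < alpha -> exists C : R, forall s u s' u' : 'cV[R]_n,
  semimonotone_at muA rhoA A (u', gamma^-1 *: (s' - u')) ->
  A u (gamma^-1 *: (s - u)) ->
  dot (u - u') (u - u') <= C * dot (s - s') (s - s').
Proof.
move=> a0.
have g0 : gamma != 0 by rewrite gt_eqF.
pose beta := gamma + rhoA + gamma ^+ 2 * muA.
have beta0 : 0 < beta.
  have : 0 < gamma * alpha by exact: mulr_gt0.
  have -> : gamma * alpha = gamma + parsum rhoA rhoB + gamma ^+ 2 * parsum muA muB.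
    by rewrite /alpha; field.
  have := parsum_le_left hrho.
  have := ler_wpM2l (sqr_ge0 gamma) (parsum_le_left hmu).
  by rewrite /beta; lra.
pose c := gamma + 2 * rhoA.
exists ((c ^+ 2 / beta - 2 * rhoA) / beta) => s u s' u' [_ hA] Au.
have := hA (u, gamma^-1 *: (s - u)) Au; rewrite !sqr_enorm /=.
set p := u - u'; set d := s - s'.
have -> : gamma^-1 *: (s - u) - gamma^-1 *: (s' - u') = gamma^-1 *: (d - p).
  by apply/colP => i; rewrite !mxE; ring.
clearbody p d => h.
have {h} : beta * dot p p <= c * dot p d - rhoA * dot d d.
  have g2 : 0 < gamma ^+ 2 by exact: exprn_gt0.
  move: h; rewrite -(ler_pM2l g2) dotZl !dotZr.
  have -> : gamma ^+ 2 * (muA * dot p p +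
      rhoA * (gamma^-1 * (gamma^-1 * dot (d - p) (d - p)))) =
    gamma ^+ 2 * muA * dot p p + rhoA * dot (d - p) (d - p) by field.
  have -> : gamma ^+ 2 * (gamma^-1 * dot p (d - p)) = gamma * dot p (d - p).
    by field.
  by rewrite !dotE (dotC d p) /beta /c; lra.
(* Young's inequality absorbs half of the left-hand side. *)
have := dotxx_ge0 (beta *: p - c *: d).
rewrite !dotE (dotC d p) => young h.
rewrite -subr_ge0.
have -> : (c ^+ 2 / beta - 2 * rhoA) / beta * dot d d - dot p p =
  (c ^+ 2 * dot d d - 2 * rhoA * beta * dot d d - beta ^+ 2 * dot p p) / beta ^+ 2.
  by field; rewrite gt_eqF.
rewrite divr_ge0 ?sqr_ge0 //.
have := ler_wpM2l (ltW beta0) h; lra.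
Qed.

End Step.

(** * The projection identifying primal-dual pairs *)

Section Projection.
Variables (R : realType) (n : nat) (gamma : R).
Hypothesis gamma_gt0 : 0 < gamma.

Lemma dot_col_mx (a c b d : 'cV[R]_n) :
  dot (col_mx a b) (col_mx c d) = dot a c + dot b d.
Proof.
rewrite /dot big_split_ord /=; congr (_ + _); apply: eq_bigr => i _.
  by rewrite !col_mxEu.
by rewrite !col_mxEd.
Qed.

Lemma dotxx_eq0 (x : 'cV[R]_n) : dot x x = 0 -> x = 0.
Proof.
move=> x0; apply/colP => i; rewrite mxE; apply/eqP.
by rewrite -sqrf_eq0 eq_le sqr_ge0 -x0 sqr_coord_le_dot.
Qed.

Let M : 'M[R]_(n + n) :=
  block_mx (gamma^-1)%:M (- 1%:M) (- 1%:M) gamma%:M.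

Lemma Pi_rangeP (w : 'cV[R]_(n + n)) :
  range (mulmx M) w <-> exists g : 'cV[R]_n, w = col_mx g (- gamma *: g).
Proof.
have g0 : gamma != 0 by rewrite gt_eqF.
split=> [[e _ <-]|[g ->]].
  exists (gamma^-1 *: usubmx e - dsubmx e).
  rewrite -[e in LHS]vsubmxK /M mul_block_col !mulNmx !mul1mx !mul_scalar_mx.
  by congr col_mx; apply/colP => i; rewrite !mxE; field.
exists (col_mx (gamma *: g) 0) => //.
rewrite /M mul_block_col !mulNmx !mul1mx !mul_scalar_mx.
by congr col_mx; apply/colP => i; rewrite !mxE; field.
Qed.

(** The range of the projection is the graph of g |-> - gamma g, whose
    orthogonality relations say that the projection of (x, y) remembers
    x - gamma y, and nothing else. *)
Lemma Pi_proj_shadow (z : 'cV[R]_(n + n)) (p := Pi_proj gamma z) :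
  usubmx z - gamma *: dsubmx z = usubmx p - gamma *: dsubmx p.
Proof.
have [_ orth] : range (mulmx M) p /\
    forall w, range (mulmx M) w -> dot (z - p) w = 0.
  apply: (@xgetPex _ 0 [set p | range (mulmx M) p /\
    forall w, range (mulmx M) w -> dot (z - p) w = 0]).
  pose c := (1 + gamma ^+ 2)^-1 *: (usubmx z - gamma *: dsubmx z).
  exists (col_mx c (- gamma *: c)); split; first by apply/Pi_rangeP; exists c.
  move=> _ /Pi_rangeP[g ->].
  rewrite -[z]vsubmxK opp_col_mx add_col_mx dot_col_mx /c !dotE.
  have g1 : 1 + gamma ^+ 2 != 0.
    by rewrite gt_eqF // ltr_pwDl // sqr_ge0.
  by field.
pose g := usubmx (z - p) - gamma *: dsubmx (z - p).
have := orth (col_mx g (- gamma *: g)) ((Pi_rangeP _).2 (ex_intro _ g erefl)).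
rewrite -[z - p]vsubmxK dot_col_mx => h.
have : dot g g = 0 by rewrite {1}/g !dotE; move: h; rewrite !dotE => h; lra.
move=> /dotxx_eq0/eqP; rewrite /g !linearB /= => /eqP g0.
apply/eqP; rewrite -subr_eq0 -[X in _ == X]g0; apply/eqP/colP => i.
by rewrite !mxE; ring.
Qed.

End Projection.

(** * Monotone sequences with a telescoping bound *)

Section Telescoping.
Variables (R : realType) (a D : nat -> R) (kappa : R).
Hypothesis kappa_gt0 : 0 < kappa.
Hypothesis a_ge0 : forall k, 0 <= a k.
Hypothesis D_ge0 : forall k, 0 <= D k.
Hypothesis a_le : forall k, kappa * a k <= D k - D k.+1.
Hypothesis a_noninc : forall k, a k.+1 <= a k.

Lemma telescoping_rate m j :
  kappa * (j.+1%:R * a (m + j)) <= D m - D (m + j).+1.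
Proof.
elim: j => [|j IH]; first by rewrite addn0 mul1r.
have h1 := a_le (m + j.+1).
have := ler_wpM2l (ler0n R j.+1) (a_noninc (m + j)).
move=> /(ler_wpM2l (ltW kappa_gt0)) h2.
rewrite -[j.+2]addn1 natrD; move: h1 h2; rewrite !addnS => h1 h2; lra.
Qed.

Lemma telescoping_le N : a N <= D 0%N / (N.+1%:R * kappa).
Proof.
rewrite ler_pdivlMr ?mulr_gt0 //.
by have := telescoping_rate 0 N; have := D_ge0 N.+1; rewrite add0n; lra.
Qed.

(** At least half of the indices up to N lie beyond the midpoint, and the mass
    there is at most the increment of the convergent sequence D between the
    midpoint and N. *)
Lemma telescoping_little_o :
  (fun N : nat => N.+1%:R * a N) @ \oo --> (0 : R).
Proof.
have Dle k : D k.+1 <= D k.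
  by rewrite -subr_ge0; apply: le_trans (a_le k); rewrite mulr_ge0 // ltW.
have /cvg_ex[l Dl] := cvg_nonincreasing D_ge0 Dle.
pose h N := uphalf N.
have h_infty : h @ \oo --> \oo.
  move=> P [N0 _ hP]; exists N0.*2 => // N /= N0N; apply: hP => /=.
  by rewrite /h uphalfE -(doubleK N0); apply: half_leq; exact: leqW.
pose f N := 2 * kappa^-1 * (D (h N) - D N.+1).
have f0 : f @ \oo --> (0 : R).
  rewrite -(mulr0 (2 * kappa^-1)) -(subrr l).
  apply: cvgM; first exact: cvg_cst.
  apply: cvgB; first by apply: (cvg_comp h D); [exact: h_infty|exact: Dl].
  by apply: cvg_subseq => // j; exact: leqnSn.
apply: (squeeze_cvgr _ (cvg_cst 0) f0); apply: nearW => N.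
rewrite mulr_ge0 //=.
have hN : (h N <= N)%N by rewrite /h leq_uphalf_double -addnn leq_addr.
have := telescoping_rate (h N) (N - h N); rewrite subnKC // => key.
have cnt : N.+1%:R <= 2 * (N - h N).+1%:R :> R.
  have -> : (N - h N)%N = N./2.
    by rewrite -{1}(odd_double_half N) /h uphalf_half -addnn addnA addKn.
  rewrite -natrM ler_nat mul2n doubleS -{1}(odd_double_half N) ltnS.
  by rewrite -[leqRHS]add1n leq_add2r leq_b1.
rewrite /f -mulrA (mulrC kappa^-1) mulrA ler_pdivlMr //.
have := ler_wpM2r (a_ge0 N) cnt => /(ler_wpM2l (ltW kappa_gt0)); lra.
Qed.

End Telescoping.

(** * Douglas-Rachford sequences *)

Section Iteration.
Variables (R : realType) (n : nat) (A B : setop R n).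
Variables (muA rhoA muB rhoB gamma : R).
Hypothesis gamma_gt0 : 0 < gamma.
Hypothesis hmu : 0 < muA + muB \/ (muA = 0 /\ muB = 0).
Hypothesis hrho : 0 < rhoA + rhoB \/ (rhoA = 0 /\ rhoB = 0).
Let alpha := 1 + gamma^-1 * parsum rhoA rhoB + gamma * parsum muA muB.
Hypothesis alpha_gt0 : 0 < alpha.
Variables (lam : nat -> R) (u v s : nat -> 'cV[R]_n).
Hypothesis drs : DRS A B gamma lam u v s.
Hypothesis lam_range : forall k, lam k \in `]0, 2 * alpha[.

Let w k := u k - v k.
Let r k := lam k * (2 * alpha - lam k).

Let gamma_neq0 : gamma != 0. Proof. by rewrite gt_eqF. Qed.

Lemma DRS_gphA k : A (u k) (gamma^-1 *: (s k - u k)).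
Proof. by apply/resolvent_scaleP => //; case: (drs k). Qed.

Lemma DRS_gphB k : B (v k) (gamma^-1 *: (2 *: u k - s k - v k)).
Proof. by apply/resolvent_scaleP => //; case: (drs k). Qed.

Lemma DRS_residual_sum k :
  [set a + b | a in A (u k) & b in B (v k)] (gamma^-1 *: (u k - v k)).
Proof.
exists (gamma^-1 *: (s k - u k)); first exact: DRS_gphA.
exists (gamma^-1 *: (2 *: u k - s k - v k)); first exact: DRS_gphB.
by apply/colP => i; rewrite !mxE; ring.
Qed.

Lemma DRS_fixed_zer k :
  u k = v k -> zer (T_PD A B) (pd_seq gamma u s k).
Proof.
move=> uv; apply/zer_T_PD_col_mx; split.
  by rewrite -scalerN opprB; exact: DRS_gphA.
have := DRS_gphB k; rewrite -uv; congr (B _ _).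
by apply/colP => i; rewrite !mxE; ring.
Qed.

Lemma relaxation_bounds k : 0 <= r k <= alpha ^+ 2.
Proof.
have := lam_range k; rewrite in_itv /= => /andP[l0 l2]; apply/andP; split.
  by rewrite mulr_ge0 // ?subr_ge0 ltW.
by rewrite -subr_ge0 /r; have := sqr_ge0 (alpha - lam k); lra.
Qed.

(** Since the residual vanishes, v has the same limit as u along phi, and the
    pairs of points of the two graphs visited by the iteration converge to pairs
    that share their primal and, up to sign, their dual component. *)
Lemma DRS_limit_zer (phi : nat -> nat) (x t : 'cV[R]_n) :
  osc A -> osc B -> (forall j, (j <= phi j)%N) -> w @ \oo --> (0 : 'cV[R]_n) ->
  (u \o phi) @ \oo --> x -> (s \o phi) @ \oo --> t ->
  zer (T_PD A B) (col_mx x (gamma^-1 *: (x - t))).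
Proof.
move=> clA clB hphi w0 ux st; apply/zer_T_PD_col_mx; split.
  rewrite -scalerN opprB.
  apply: (osc_seq_limit clA (fun j => DRS_gphA (phi j)) ux).
  by apply: cvgZ; [exact: cvg_cst|apply: cvgB].
have wphi : (w \o phi) @ \oo --> (0 : 'cV[R]_n) by exact: cvg_subseq.
have vx : (v \o phi) @ \oo --> x.
  rewrite -[x]subr0 (_ : v \o phi = (fun j => (u \o phi) j - (w \o phi) j)).
    exact: cvgB.
  by apply/funext => j; rewrite /= /w subKr.
have -> : gamma^-1 *: (x - t) = gamma^-1 *: (2 *: x - t - x).
  by apply/colP => i; rewrite !mxE; ring.
apply: (osc_seq_limit clB (fun j => DRS_gphB (phi j)) vx).
have u2 : (fun j => 2 *: (u \o phi) j) @ \oo --> 2 *: x.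
  by apply: cvgZ; [exact: cvg_cst|exact: ux].
apply: cvgZ; first exact: cvg_cst.
exact: (cvgB (cvgB u2 st) vx).
Qed.

Section Fejer.
Variables x y : 'cV[R]_n.
Hypothesis solA : semimonotone_at muA rhoA A (x, - y).
Hypothesis solB : semimonotone_at muB rhoB B (x, y).
Let t := x - gamma *: y.
Let D k := dot (s k - t) (s k - t).

Let solA' : semimonotone_at muA rhoA A (x, gamma^-1 *: (t - x)).
Proof.
suff -> : gamma^-1 *: (t - x) = - y by [].
by rewrite /t addrAC subrr add0r scalerN scalerA mulVf // scale1r.
Qed.

Let solB' : semimonotone_at muB rhoB B (x, gamma^-1 *: (2 *: x - t - x)).
Proof.
suff -> : gamma^-1 *: (2 *: x - t - x) = y by [].
by apply/colP => i; rewrite !mxE; field.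
Qed.

Lemma residual_dot_le k : alpha * dot (w k) (w k) <= dot (w k) (s k - t).
Proof.
have := residual_cocoercive gamma_gt0 hmu hrho solA' solB'
  (DRS_gphA k) (DRS_gphB k).
by rewrite subrr subr0.
Qed.

(** A step moves s by - lam w, and the inner product of w with s - t is at
    least alpha times the squared norm of w. *)
Lemma fejer_step k : r k * dot (w k) (w k) <= D k - D k.+1.
Proof.
have := lam_range k; rewrite in_itv /= => /andP[l0 _].
have [_ _ sE] := drs k.
have -> : D k - D k.+1 =
    2 * lam k * dot (w k) (s k - t) - lam k ^+ 2 * dot (w k) (w k).
  rewrite /D; have -> : s k.+1 - t = (s k - t) - lam k *: w k.
    by rewrite sE /w; apply/colP => i; rewrite !mxE; ring.
  move: (s k - t) (w k) => a b.
  by rewrite !dotE (dotC a b); ring.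
have := ler_wpM2l (ltW l0) (residual_dot_le k); rewrite /r; lra.
Qed.

Let D_ge0 k : 0 <= D k. Proof. exact: dotxx_ge0. Qed.

Lemma fejer_noninc k : D k.+1 <= D k.
Proof.
rewrite -subr_ge0; apply: le_trans (fejer_step k).
by rewrite mulr_ge0 ?dotxx_ge0 //; case/andP: (relaxation_bounds k).
Qed.

Lemma fejer_bounded k : D k <= D 0%N.
Proof. by elim: k => // k; exact: le_trans (fejer_noninc k). Qed.

Lemma fejer_sum N :
  \sum_(k < N) r k * dot (w k) (w k) <= D 0%N - D N.
Proof.
elim: N => [|N IH]; first by rewrite big_ord0 subrr.
by rewrite big_ord_recr /=; have := fejer_step N; lra.
Qed.

Lemma DRS_s_bounded : exists M : R, forall k, dot (s k) (s k) <= M.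
Proof.
exists (2 * D 0%N + 2 * dot t t) => k.
have := fejer_bounded k; have := dotxx_ge0 (s k - t - t).
rewrite /D !dotE; lra.
Qed.

Lemma DRS_u_bounded : exists M : R, forall k, dot (u k) (u k) <= M.
Proof.
have [C hC] := resolvent_growth A gamma_gt0 hmu hrho alpha_gt0.
exists (2 * (`|C| * D 0%N) + 2 * dot x x) => k.
have := hC _ _ _ _ solA' (DRS_gphA k); rewrite -/(D k) => h1.
have h2 : C * D k <= `|C| * D 0%N.
  apply: le_trans (ler_wpM2r (D_ge0 k) (ler_norm C)) _.
  by rewrite ler_wpM2l // fejer_bounded.
have := dotxx_ge0 (u k - x - x); move: h1; rewrite !dotE; lra.
Qed.

Lemma residual_cvg0 : 0 < limn_inf r -> w @ \oo --> (0 : 'cV[R]_n).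
Proof.
move=> /(limn_inf_gt0_near relaxation_bounds)[c c0 rc].
have /cvg_ex[l Dl] := cvg_nonincreasing D_ge0 fejer_noninc.
pose f k := c^-1 * (D k - D k.+1).
have f0 : f @ \oo --> (0 : R).
  rewrite -(mulr0 c^-1) -(subrr l); apply: cvgM; first exact: cvg_cst.
  by apply: cvgB => //; apply: cvg_subseq Dl => j; exact: leqnSn.
apply: cvg_of_dot_cvg0; apply: (squeeze_cvgr _ (cvg_cst 0) f0).
apply: filterS rc => k rck; rewrite subr0 dotxx_ge0 /= /f mulrC ler_pdivlMr //.
apply: le_trans (fejer_step k); rewrite mulrC ler_wpM2r //; exact: dotxx_ge0.
Qed.

Lemma fejer_subseq_cvg (phi : nat -> nat) :
  (forall j, (j <= phi j)%N) -> (s \o phi) @ \oo --> t -> s @ \oo --> t.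
Proof.
move=> hphi st; have /cvg_ex[l Dl] := cvg_nonincreasing D_ge0 fejer_noninc.
apply: cvg_of_dot_cvg0; rewrite -/D.
suff <- : l = 0 by [].
have Dphi : (D \o phi) @ \oo --> l by exact: cvg_subseq.
have D0 : (D \o phi) @ \oo --> (0 : R).
  have -> : 0 = dot (t - t) (t - t) :> R by rewrite subrr -(scale0r t) dotZl mul0r.
  by apply: cvg_dot; (apply: cvgB; [exact: st|exact: cvg_cst]).
exact: (cvg_unique _ Dphi D0).
Qed.

Lemma min_residual_le (kappa : R) : 0 < kappa -> (forall k, kappa <= r k) ->
  forall N : nat,
    \big[Num.min/enorm (w 0%N) ^+ 2]_(k < N.+1) enorm (w k) ^+ 2
      <= enorm (s 0%N - t) ^+ 2 / (N.+1%:R * kappa).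
Proof.
move=> k0 kr N; rewrite (sqr_enorm (s 0%N - t)) -/(D 0%N) ler_pdivlMr ?mulr_gt0 //.
set m := \big[_/_]_(_ < _) _.
have : \sum_(k < N.+1) kappa * m <= \sum_(k < N.+1) r k * dot (w k) (w k).
  apply: ler_sum => k _; apply: (@le_trans _ _ (kappa * dot (w k) (w k))).
    by rewrite ler_wpM2l ?(ltW k0) // -sqr_enorm; exact: bigmin_le_cond.
  by rewrite ler_wpM2r ?dotxx_ge0.
rewrite sumr_const card_ord.
have -> : (kappa * m) *+ N.+1 = m * (N.+1%:R * kappa).
  by rewrite -mulr_natl; ring.
move=> h; apply: le_trans (le_trans h (fejer_sum N.+1)) _.
by rewrite gerBl.
Qed.

Lemma residual_rates (kappa : R) : semimonotone muA rhoA A ->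
  semimonotone muB rhoB B -> 0 < kappa -> (forall k, kappa <= r k) ->
  (forall N : nat, enorm (w N) ^+ 2
     <= enorm (s 0%N - t) ^+ 2 / (N.+1%:R * kappa)) /\
  (fun N : nat => N.+1%:R * enorm (w N) ^+ 2) @ \oo --> (0 : R).
Proof.
move=> smA smB k0 kr; pose a k := dot (w k) (w k).
have a_ge0 k : 0 <= a k by exact: dotxx_ge0.
have a_le k : kappa * a k <= D k - D k.+1.
  by apply: le_trans (fejer_step k); rewrite ler_wpM2r.
(* Two consecutive iterates differ by lam w with lam < 2 alpha, so
   cocoercivity of the residual makes the residual norms nonincreasing. *)
have a_noninc k : a k.+1 <= a k.
  have := lam_range k; rewrite in_itv /= => /andP[l0 l2].
  have [_ _ sE] := drs k.
  have := residual_cocoercive gamma_gt0 hmu hrho (smA (_, _) (DRS_gphA k.+1))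
    (smB (_, _) (DRS_gphB k.+1)) (DRS_gphA k) (DRS_gphB k).
  rewrite -/(w k) -/(w k.+1) -/alpha.
  have -> : s k - s k.+1 = lam k *: w k.
    by rewrite sE /w; apply/colP => i; rewrite !mxE; ring.
  rewrite dotZr => h.
  have h2 := ler_wpM2r (dotxx_ge0 (w k - w k.+1)) (ltW l2).
  have : lam k * dot (w k - w k.+1) (w k - w k.+1) <=
         lam k * (2 * dot (w k - w k.+1) (w k)) by lra.
  rewrite ler_pM2l // /a; move: (w k) (w k.+1) => p q.
  rewrite !dotE (dotC q p); lra.
split=> [N|]; last first.
  under eq_fun do rewrite sqr_enorm.
  exact: (telescoping_little_o k0 a_ge0 D_ge0 a_le a_noninc).
by rewrite !sqr_enorm; exact: (telescoping_le k0 D_ge0 a_le a_noninc).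
Qed.

End Fejer.

End Iteration.

Theorem theorem5p2 (R : realType) (n : nat) (A B : setop R n)
    (muA rhoA muB rhoB gamma : R) (S : set 'cV[R]_(n + n))
    (hP : assumption_P muA rhoA muB rhoB)
    (hgamma : stepsize_range muA rhoA muB rhoB gamma)
    (hab : hyp_a A B muA rhoA muB rhoB gamma S \/
           (hyp_b A B muA rhoA muB rhoB /\ S = zer (T_PD A B))) :
  let alpha := 1 + gamma^-1 * parsum rhoA rhoB + gamma * parsum muA muB in
  0 < alpha /\
  forall (lam : nat -> R) (u v s : nat -> 'cV[R]_n),
    DRS A B gamma lam u v s ->
    (forall k, lam k \in `]0, 2 * alpha[) ->
    0 < limn_inf (fun k => lam k * (2 * alpha - lam k)) ->
    let z := pd_seq gamma u s in
    (forall k, u k = v k -> zer (T_PD A B) (z k)) /\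
    ((exists k, u k = v k) \/
     [/\ (* (i) *)
         (forall k, [set a + b | a in A (u k) & b in B (v k)]
                      (gamma^-1 *: (u k - v k))) /\
         (fun k => u k - v k) @ \oo --> (0 : 'cV[R]_n),
         (* (ii) *)
         cluster (z @ \oo) `<=` zer (T_PD A B),
         (* (iii) *)
         bounded_fun s /\
         cluster (s @ \oo) `<=` s_set gamma (zer (T_PD A B)),
         (* (iv) *)
         (forall kappa : R, 0 < kappa ->
           (forall k, kappa <= lam k * (2 * alpha - lam k)) ->
           forall sstar, s_set gamma S sstar -> forall N : nat,
             \big[Num.min/enorm (u 0%N - v 0%N) ^+ 2]_(k < N.+1)
                 enorm (u k - v k) ^+ 2
               <= enorm (s 0%N - sstar) ^+ 2 / (N.+1%:R * kappa))
       & (* (v) *)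
         (Pi_proj gamma @` S = Pi_proj gamma @` zer (T_PD A B) ->
           (exists2 sbar, s_set gamma (zer (T_PD A B)) sbar
                        & s @ \oo --> sbar) /\
           (single_valued_continuous (resolvent (op_scale gamma A)) ->
            single_valued_continuous (resolvent (op_scale gamma B)) ->
            exists2 zbar, zer (T_PD A B) zbar & z @ \oo --> zbar))]) /\
    (hyp_b A B muA rhoA muB rhoB ->
      forall kappa : R, 0 < kappa ->
        (forall k, kappa <= lam k * (2 * alpha - lam k)) ->
        (forall sstar, s_set gamma (zer (T_PD A B)) sstar -> forall N : nat,
           enorm (u N - v N) ^+ 2
             <= enorm (s 0%N - sstar) ^+ 2 / (N.+1%:R * kappa)) /\
        (fun N : nat => N.+1%:R * enorm (u N - v N) ^+ 2) @ \oo --> (0 : R)).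
Proof.
have [hmu hrho _] := hP.
have [g0 quad] := stepsize_range_pos hP hgamma.
move=> alpha; have alpha_gt0 : 0 < alpha.
  rewrite -(pmulr_rgt0 _ g0).
  have -> : gamma * alpha =
      gamma + parsum rhoA rhoB + gamma ^+ 2 * parsum muA muB.
    by rewrite /alpha; field; rewrite gt_eqF.
  exact: quad.
split=> // lam u v s drs lam_range liminf_gt0 z.
split; first exact: DRS_fixed_zer.
split; last first.
  move=> hb kappa k0 kr; have [_ [[smA _] [smB _]]] := hb.
  have [_ _ [z0 hz0] sol] := hyp_b_regular hb.
  have rates x y (a : semimonotone_at muA rhoA A (x, - y))
      (b : semimonotone_at muB rhoB B (x, y)) :=
    residual_rates g0 hmu hrho drs lam_range a b smA smB k0 kr.
  split=> [_ [z' hz' <-] N|]; last first.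
    by move: hz0; rewrite -[z0]vsubmxK => /sol[a b]; case: (rates _ _ a b).
  by move: hz'; rewrite -[z']vsubmxK col_mxKu col_mxKd => /sol[a b];
    case: (rates _ _ a b) => /(_ N).
right.
have [oscA oscB [z0 Sz0] Szer sol] : [/\ osc A, osc B, S !=set0,
    S `<=` zer (T_PD A B) & forall x y, S (col_mx x y) ->
    semimonotone_at muA rhoA A (x, - y) /\ semimonotone_at muB rhoB B (x, y)].
  case: hab => [[? [? [_ [_ [? [? ?]]]]]]|[hb ->]].
    by split.
  by have [? ? ? ?] := hyp_b_regular hb; split.
have sol' z' : S z' -> semimonotone_at muA rhoA A (usubmx z', - dsubmx z') /\
    semimonotone_at muB rhoB B (usubmx z', dsubmx z').
  by move=> Sz'; apply: sol; rewrite vsubmxK.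
have [solA0 solB0] := sol' _ Sz0.
have w0 := residual_cvg0 g0 hmu hrho drs lam_range solA0 solB0 liminf_gt0.
have limit_zer := DRS_limit_zer g0 drs oscA oscB _ w0.
have [Mu hMu] := DRS_u_bounded g0 hmu hrho alpha_gt0 drs lam_range solA0 solB0.
have [Ms hMs] := DRS_s_bounded g0 hmu hrho drs lam_range solA0 solB0.
(* A convergent subsequence of s has a further subsequence along which u
   converges. *)
have refine_subseq (phi : nat -> nat) (t : 'cV[R]_n) : (forall j, (j <= phi j)%N) ->
    (s \o phi) @ \oo --> t ->
    exists x : 'cV[R]_n, exists2 psi : nat -> nat, (forall j, (j <= psi j)%N) &
      (u \o psi) @ \oo --> x /\ (s \o psi) @ \oo --> t.
  move=> hphi st; have [x [psi hpsi ux]] := bounded_subseq (fun k => hMu (phi k)).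
  exists x, (phi \o psi) => [j|]; first exact: leq_trans (hpsi j) (hphi _).
  by split=> //; exact: (cvg_subseq hpsi st).
have s_limit (phi : nat -> nat) (t : 'cV[R]_n) : (forall j, (j <= phi j)%N) ->
    (s \o phi) @ \oo --> t -> s_set gamma (zer (T_PD A B)) t.
  move=> hphi st; have [x [psi hpsi [ux st']]] := refine_subseq _ _ hphi st.
  exists (col_mx x (gamma^-1 *: (x - t))); first exact: (limit_zer psi).
  rewrite col_mxKu col_mxKd scalerA mulfV ?gt_eqF // scale1r.
  by rewrite opprB addrC subrK.
split.
- by split=> //; exact: DRS_residual_sum.
- move=> l /cluster_subseq[phi hphi zl].
  have ux : (u \o phi) @ \oo --> usubmx l.
    rewrite (_ : u \o phi = (fun k => usubmx ((z \o phi) k))).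
      exact: cvg_usubmx.
    by apply/funext => k; rewrite /= /z /pd_seq col_mxKu.
  have st : (s \o phi) @ \oo --> usubmx l - gamma *: dsubmx l.
    rewrite (_ : s \o phi =
      (fun k => (u \o phi) k - gamma *: dsubmx ((z \o phi) k))).
      exact: (cvgB ux (cvgZ (cvg_cst gamma) (cvg_dsubmx zl))).
    apply/funext => k; rewrite /= /z /pd_seq col_mxKd.
    by rewrite scalerA mulfV ?gt_eqF // scale1r subKr.
  have := limit_zer phi _ _ hphi ux st.
  by rewrite subKr scalerA mulVf ?gt_eqF // scale1r vsubmxK.
- split; first exact: bounded_fun_of_dot hMs.
  by move=> t /cluster_subseq[phi hphi st]; exact: s_limit st.
- move=> kappa k0 kr _ [z' Sz' <-] N; have [solA solB] := sol' _ Sz'.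
  exact: (min_residual_le g0 hmu hrho drs lam_range solA solB k0 kr).
- move=> hPi.
  (* The equality of projections turns every limit point of s into the image
     of a point of S, with respect to which s is Fejer monotone. *)
  have shadow t : s_set gamma (zer (T_PD A B)) t -> s_set gamma S t.
    move=> [z' hz' <-].
    have : [set Pi_proj gamma x | x in S] (Pi_proj gamma z').
      by rewrite hPi; exists z'.
    move=> [z'' Sz'' zz]; exists z'' => //.
    by rewrite [LHS](Pi_proj_shadow g0) [RHS](Pi_proj_shadow g0) zz.
  have [sbar [phi hphi sphi]] := bounded_subseq hMs.
  have zer_sbar := s_limit _ _ hphi sphi.
  have s_cvg : s @ \oo --> sbar.
    have [z' Sz' zE] := shadow _ zer_sbar; have [solA solB] := sol' _ Sz'.
    rewrite -zE; apply: (fejer_subseq_cvg g0 hmu hrho drs lam_range solA solB hphi).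
    by rewrite zE.
  split; first by exists sbar.
  move=> [f [fE cf]] _.
  have g_neq0 : gamma != 0 by rewrite gt_eqF.
  have dom_sbar : dom (resolvent (op_scale gamma A)) sbar.
    have [x [psi hpsi [ux st]]] := refine_subseq _ _ hphi sphi.
    exists x; apply/resolvent_scaleP => //.
    by have /zer_T_PD_col_mx[] := limit_zer _ _ _ hpsi ux st; rewrite -scalerN opprB.
  have dom_s k : dom (resolvent (op_scale gamma A)) (s k).
    by exists (u k); case: (drs k).
  have uE : u = f \o s.
    by apply/funext => k; have [+ _ _] := drs k; rewrite (fE _ (dom_s k)).
  have u_cvg : u @ \oo --> f sbar.
    rewrite uE => P /((subspace_continuousP _ _).1 cf _ dom_sbar) hP'.
    have [N _ hN] := s_cvg _ hP'.
    by exists N => // k /hN; apply; exact: dom_s.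
  exists (col_mx (f sbar) (gamma^-1 *: (f sbar - sbar))).
    exact: (limit_zer id _ _ (fun j => leqnn j) u_cvg s_cvg).
  apply: (cvg_col_mx u_cvg).
  by apply: cvgZ; [exact: cvg_cst|exact: (cvgB u_cvg s_cvg)].
Qed.
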